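(* Let $G$ be a finitely generated group with $d(G) \leq 3$, and let $H$ be a subgroup of finite index in $G$. Then the following are equivalent: 1. There exists a left-right transversal $T$ for $H$ in $G$ with $\langle T \rangle = G$. 2. $[G:H] \geq d(G)$.
   Context: For a finitely generated group $G$, $d(G)$ denotes the minimal number of elements in a generating set of $G$. A left-right transversal for $H$ in $G$ is a set which is simultaneously a left transversal (contains exactly one element of each left coset $gH$) and a right transversal (contains exactly one element of each right coset $Hg$) for $H$ in $G$. *)

(* Defs.v *)
From HB Require Import structures.
From mathcomp Require Import all_boot finmap all_classical.

Set Implicit Arguments.
Unset Strict Implicit.
Unset Printing Implicit Defensive.

Local Open Scope classical_set_scope.
Local Open Scope group_scope.

(* [groupType] is MathComp's structure of possibly infinite groups. The
   [choiceType] it carries is no restriction, since choice is available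
   classically on every type ([boolp.gen_choiceMixin]). *)

Definition subgroup (G : groupType) (H : set G) : Prop := group_closed [in H].

Definition generated (G : groupType) (A : set G) : set G :=
  smallest (@subgroup G) A.

Definition generates (G : groupType) (A : set G) : Prop :=
  generated A = [set: G].

Definition finitely_generated (G : groupType) : Prop :=
  exists A : set G, finite_set A /\ generates A.

Definition generating_sizes (G : groupType) : set nat :=
  [set n | exists A : set G, (A #= `I_n)%card /\ generates A].

(* The least element of [generating_sizes G]; the default value 0 is only
   reached when G is not finitely generated. *)
Definition d (G : groupType) : nat :=
  xget 0%N [set n | generating_sizes G n /\
                    forall m, generating_sizes G m -> (n <= m)%N].

Definition left_coset (G : groupType) (H : set G) (g : G) : set G :=
  [set g * h | h in H].

Definition right_coset (G : groupType) (H : set G) (g : G) : set G :=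
  [set h * g | h in H].

Definition left_cosets (G : groupType) (H : set G) : set (set G) :=
  range (left_coset H).

Definition right_cosets (G : groupType) (H : set G) : set (set G) :=
  range (right_coset H).

Definition finite_index (G : groupType) (H : set G) : Prop :=
  finite_set (left_cosets H).

(* Meaningful under [finite_index H] only: [fset_set] maps infinite sets to
   the empty one. *)
Definition subgroup_index (G : groupType) (H : set G) : nat :=
  #|` fset_set (left_cosets H)|%fset.

Definition left_transversal (G : groupType) (H T : set G) : Prop :=
  forall C, left_cosets H C -> exists! t, (T `&` C) t.

Definition right_transversal (G : groupType) (H T : set G) : Prop :=
  forall C, right_cosets H C -> exists! t, (T `&` C) t.

Definition left_right_transversal (G : groupType) (H T : set G) : Prop :=
  left_transversal H T /\ right_transversal H T.

(* Main.v *)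
(* A finite set of elements lying in distinct left and distinct right cosets of
   H always extends to a left-right transversal, because H g H splits into
   equally many left and right cosets, each of the former meeting each of the
   latter. So it suffices to find a generating set of this kind. If two
   generators x, y lie in the same left (right) coset, replace one of them by
   x^-1 y (x y^-1), which is in H; this only raises the number of generators in
   H. It ends with a suitable generating set unless d(G) = 3 and a, b are in H,
   c is not. Then {b, c, c a c}, {a, c, c b c} or {b, c, c a b c} is suitable:
   otherwise c swaps H and cH while a and b fix both, and H has index 2. *)

Require Import Defs.
From mathcomp Require Import all_boot finmap all_classical.

Set Implicit Arguments.
Unset Strict Implicit.
Unset Printing Implicit Defensive.

Local Open Scope classical_set_scope.
Local Open Scope group_scope.

Lemma uniq_map_inj (T U : eqType) (f : T -> U) (s : seq T) :
  uniq (map f s) -> {in s &, injective f}.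
Proof.
elim: s => //= z s IHs /andP[/mapP zNs Us] x y; rewrite !inE.
move=> /orP[/eqP->|xs] /orP[/eqP->|ys] // Exy; last exact: IHs.
  by case: zNs; exists y.
by case: zNs; exists x.
Qed.

(** * Subgroups, generated subgroups and changes of generators *)

Section Subgroup.
Variables (G : groupType) (K : set G).
Hypothesis sgK : subgroup K.

Lemma subgroup1 : K 1.
Proof. by case: sgK => /set_mem. Qed.

Lemma subgroupM x y : K x -> K y -> K (x * y).
Proof.
by move=> Kx Ky; apply/set_mem/(group_closedM sgK); exact/mem_set.
Qed.

Lemma subgroupV x : K x -> K x^-1.
Proof. by move=> Kx; apply/set_mem/(group_closedV sgK); exact/mem_set. Qed.

Lemma subgroupMl x y : K x -> K (x * y) <-> K y.
Proof.
move=> Kx; split=> [Kxy|]; last exact: subgroupM.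
by rewrite -(mulKg x y); apply/subgroupM/Kxy/subgroupV.
Qed.

Lemma subgroupVE x : K x^-1 <-> K x.
Proof. by split=> /subgroupV; rewrite ?invgK. Qed.

End Subgroup.

Lemma subgroup_intro (G : groupType) (K : set G) :
  K 1 -> (forall x y, K x -> K y -> K (x / y)) -> subgroup K.
Proof.
move=> K1 KB; split; first exact/mem_set.
by move=> x y /set_mem Kx /set_mem Ky; apply/mem_set/KB.
Qed.

Section Generation.
Variable G : groupType.
Implicit Types A B K : set G.

Lemma generated_subgroup A : subgroup (generated A).
Proof.
apply: subgroup_intro => [K [sgK _]|x y Ax Ay K [sgK AK]].
  exact: subgroup1.
by apply: subgroupM; [| apply: Ax | apply: subgroupV => //; apply: Ay].
Qed.

(** The induction principle for a generated group; below it is applied to [H] itself and to a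
    stabilizer. *)
Lemma generates_subgroup A K :
  generates A -> subgroup K -> A `<=` K -> forall x, K x.
Proof.
move=> genA sgK AK x; apply: (smallest_sub sgK AK).
by rewrite -/(generated A) genA.
Qed.

Lemma generates_sub A B : generates A -> A `<=` generated B -> generates B.
Proof.
move=> genA AB; apply/seteqP; split=> // x _.
exact: (generates_subgroup genA (generated_subgroup B) AB).
Qed.

Lemma mem_generated (s : seq G) x : x \in s -> generated [set` s] x.
Proof. by move=> xs K [_]; apply. Qed.

Lemma generates_seq (s t : seq G) :
  generates [set` s] -> {in s, forall x, generated [set` t] x} ->
  generates [set` t].
Proof. by move=> gens st; apply: generates_sub gens _ => x /st. Qed.

Lemma generates_eq_mem (s t : seq G) :
  s =i t -> generates [set` s] -> generates [set` t].
Proof.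
by move=> st gens; apply: generates_seq gens _ => x; rewrite st;
  exact: mem_generated.
Qed.

(** Meant for [a] and [b] in one left coset of [H]: the new generator is then in [H]. It is put
    first, where the later lemmas expect a generator from [H]. *)
Lemma generates_divl (a b : G) (s : seq G) :
  generates [set` [:: a, b & s]] -> generates [set` [:: a^-1 * b, a & s]].
Proof.
move=> gens; apply: generates_seq gens _ => x; pose t := [:: a^-1 * b, a & s].
have gM := subgroupM (generated_subgroup [set` t]).
have gt y : y \in t -> generated [set` t] y by exact: mem_generated.
rewrite !inE => /or3P[/eqP->|/eqP->|xs];
  last by apply: gt; rewrite !inE xs !orbT.
  by apply: gt; rewrite !inE eqxx orbT.
by rewrite -[X in generated _ X](mulVKg a b);
  apply: gM; apply: gt; rewrite !inE eqxx ?orbT.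
Qed.

Lemma generates_divr (a b : G) (s : seq G) :
  generates [set` [:: a, b & s]] -> generates [set` [:: a * b^-1, b & s]].
Proof.
move=> gens; apply: generates_seq gens _ => x; pose t := [:: a * b^-1, b & s].
have gM := subgroupM (generated_subgroup [set` t]).
have gt y : y \in t -> generated [set` t] y by exact: mem_generated.
rewrite !inE => /or3P[/eqP->|/eqP->|xs];
  last by apply: gt; rewrite !inE xs !orbT.
  by rewrite -[X in generated _ X](mulgVK b a);
  apply: gM; apply: gt; rewrite !inE eqxx ?orbT.
by apply: gt; rewrite !inE eqxx orbT.
Qed.

Lemma generates_sandwich (a b c : G) :
  generates [set` [:: a; b; c]] -> generates [set` [:: b; c; c * a * c]].
Proof.
move=> gens; apply: generates_seq gens _ => x; pose t := [:: b; c; c * a * c].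
have gM := subgroupM (generated_subgroup [set` t]).
have gV := subgroupV (generated_subgroup [set` t]).
have gt y : y \in t -> generated [set` t] y by exact: mem_generated.
have gc : generated [set` t] c by apply: gt; rewrite !inE eqxx orbT.
rewrite !inE => /or3P[]/eqP-> //; last by apply: gt; rewrite !inE eqxx.
rewrite [X in generated _ X](_ : a = c^-1 * (c * a * c) * c^-1); last first.
  by rewrite -mulgA mulgK mulKg.
apply: (gM); last exact: gV.
by apply: gM; [exact: gV | apply: gt; rewrite !inE eqxx !orbT].
Qed.

Lemma generates_mul (a b : G) (s : seq G) :
  generates [set` [:: a, b & s]] -> generates [set` [:: a * b, b & s]].
Proof.
move=> gens; apply: generates_seq gens _ => x; pose t := [:: a * b, b & s].
have gM := subgroupM (generated_subgroup [set` t]).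
have gV := subgroupV (generated_subgroup [set` t]).
have gt y : y \in t -> generated [set` t] y by exact: mem_generated.
have gb : generated [set` t] b by apply: gt; rewrite !inE eqxx orbT.
rewrite !inE => /or3P[/eqP->|/eqP->|xs] //;
  last by apply: gt; rewrite !inE xs !orbT.
rewrite -[X in generated _ X](mulgK b a); apply: gM; last exact: gV.
by apply: gt; rewrite !inE eqxx.
Qed.

End Generation.

(** * Extending partial transversals, with left cosets indexed by a finite type *)

Section LeftRightTransversal.
Variables (G : groupType) (H : set G) (X : finType).
Variables (idx : G -> X) (rep : X -> G).
Hypothesis sgH : subgroup H.
Hypothesis idxP : forall x y, idx x = idx y <-> H (x^-1 * y).
Hypothesis repK : cancel rep idx.
Implicit Types (s t : seq G).

(** Inversion turns the right coset Hx into the left coset x^-1 H, so [X] indexes the cosets of both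
    kinds. *)
Definition ridx x := idx x^-1.

Lemma ridxP x y : ridx x = ridx y <-> H (x * y^-1).
Proof. by rewrite /ridx idxP invgK. Qed.

Lemma idxM x y z : idx (x * y) = idx (x * z) <-> idx y = idx z.
Proof. by rewrite !idxP invgM mulgA mulgVK. Qed.

Section DoubleCosetCount.
Variable D : pred G.
Hypothesis DH : forall x h, H h -> D (x * h) = D x.
Hypothesis HD : forall x h, H h -> D (h * x) = D x.

Lemma D_rep x : D (rep (idx x)) = D x.
Proof.
have /idxP Hx := repK (idx x).
by rewrite -(DH _ Hx) mulVKg.
Qed.

Lemma D_repV x : D (rep (idx x^-1))^-1 = D x.
Proof.
have /idxP Hx := repK (idx x^-1).
by rewrite -[RHS](HD _ Hx) mulgVK.
Qed.

(* Double count the pairs (i, j) such that (rep i)^-1 * rep j lies in D. *)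
Lemma card_left_right_cosets :
  #|[set i | D (rep i)]%SET| = #|[set i | D (rep i)^-1]%SET|.
Proof.
have injM x : injective (fun j => idx (x * rep j)).
  by move=> j k /idxM; rewrite !repK.
have X0 : (0 < #|X|)%N by apply/card_gt0P; exists (idx 1).
(* Multiplying by the nonzero [#|X|] turns both sides into sums over pairs. *)
apply/eqP; rewrite -(eqn_pmul2l X0) -!sum_nat_const !cardsE -!sum1_card.
pose F i j : nat := D ((rep i)^-1 * rep j).
(* Left translation by [(rep i)^-1] permutes the left cosets, so every row has the same sum. *)
have El i : (\sum_(k in [pred k | D (rep k)]) 1 = \sum_j F i j)%N.
  rewrite big_mkcond (reindex_inj (injM (rep i)^-1)) /=.
  by apply: eq_bigr => j _; rewrite inE D_rep /F; case: (D _).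
(* The same permutation for columns, since [(rep i)^-1 * rep j] is the inverse of
   [(rep j)^-1 * rep i]. *)
have Er j : (\sum_(k in [pred k | D (rep k)^-1]) 1 = \sum_i F i j)%N.
  rewrite big_mkcond (reindex_inj (injM (rep j)^-1)) /=.
  apply: eq_bigr => i _.
  by rewrite inE /F -[(rep j)^-1 * _]invgK D_repV invgM invgK; case: (D _).
rewrite (eq_bigr (fun i => \sum_j F i j)%N) // exchange_big /=.
by apply/eqP; apply: eq_bigr => j _; rewrite -Er.
Qed.

End DoubleCosetCount.

Definition lr_free s := uniq (map idx s) && uniq (map ridx s).

Lemma lr_free_extend1 s :
  lr_free s -> (size s < #|X|)%N -> exists g, lr_free (g :: s).
Proof.
case/andP=> Us Vs ltsX.
have [i iNs] : exists i, i \notin map idx s.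
  apply/existsP; rewrite -negb_forall; apply: contraL ltsX => /forallP sX.
  rewrite -leqNgt -(size_map idx) -(card_uniqP Us).
  by apply/subset_leq_card/fintype.subsetP => i _; exact: sX.
(* The double coset of a left coset that [s] misses. *)
pose D x := `[< exists h k, [/\ H h, H k & x = h * rep i * k] >].
have DH x h : H h -> D (x * h) = D x.
  move=> Hh; apply/asboolP/asboolP=> -[a [b [Ha Hb]]] E.
    exists a, (b * h^-1); split=> //; first exact/(subgroupM sgH)/(subgroupV sgH).
    by rewrite mulgA -E mulgK.
  by exists a, (b * h); split=> //; [exact: (subgroupM sgH)|rewrite mulgA E].
have HD x h : H h -> D (h * x) = D x.
  move=> Hh; apply/asboolP/asboolP=> -[a [b [Ha Hb]]] E.
    exists (h^-1 * a), b; split=> //; first exact/(subgroupM sgH)/Ha/(subgroupV sgH).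
    by rewrite -!mulgA [a * _]mulgA -E mulKg.
  by exists (h * a), b; split=> //; [exact: (subgroupM sgH)|rewrite E !mulgA].
have Di : D (rep i).
  by apply/asboolP; exists 1, 1; rewrite mul1g mulg1; split=> //; exact: subgroup1.
(* The entries of [s] in [D] occupy distinct left cosets inside [D], and [i] is not among them. *)
have lt_card : (size [seq x <- s | D x] < #|[set k | D (rep k)]%SET|)%N.
  have U : uniq (i :: map idx [seq x <- s | D x]).
    rewrite /= (subseq_uniq _ Us) ?map_subseq ?filter_subseq // andbT.
    by apply: contra iNs; apply/mem_subseq/map_subseq/filter_subseq.
  rewrite -(size_map idx) -[X in (X <= _)%N]/(size (i :: _)) -(card_uniqP U).
  apply/subset_leq_card/fintype.subsetP => k.
  rewrite finset.in_set in_cons => /orP[/eqP->//|].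
  by case/mapP=> x; rewrite mem_filter => /andP[Dx _] ->; rewrite D_rep.
(* [D] has as many right cosets as left ones, hence more than [s] has entries in [D]; one of them is
   missed. *)
have [k Dk kNs] : exists2 k, D (rep k)^-1 & k \notin map ridx s.
  apply/exists2P; apply: contrapT => /forallNP noK.
  suff: (#|[set k | D (rep k)^-1]%SET| <= size [seq x <- s | D x])%N.
    by rewrite -card_left_right_cosets // leqNgt lt_card.
  rewrite -(size_map ridx).
  apply: leq_trans (card_size _); apply/subset_leq_card/fintype.subsetP => k.
  rewrite finset.in_set => Dk; have : k \in map ridx s.
    by apply: contrapT => /negP kNs; apply: (noK k).
  case/mapP=> x xs Ek; apply/mapP; exists x => //; rewrite mem_filter xs.
  by rewrite andbT -D_repV // -/(ridx x) -Ek.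
(* From [(rep k)^-1 = a * rep i * b], the element [rep i * b] lies both in the missed left coset and
   in the missed right coset. *)
have /asboolP[a [b [Ha Hb E]]] := Dk.
exists (rep i * b); apply/andP; split; rewrite /= ?Us ?Vs andbT.
  rewrite (_ : idx _ = i) // -[RHS]repK; apply/idxP.
  by rewrite invgM mulgVK; exact: subgroupV.
rewrite (_ : ridx _ = k) // -[RHS]repK -[rep k]invgK; apply/ridxP.
by rewrite invgK -[rep k]invgK E !invgM !mulgA mulgK mulgV mul1g; exact: subgroupV.
Qed.

Lemma lr_free_extend s :
  lr_free s -> exists t, [/\ lr_free t, {subset s <= t} & size t = #|X|].
Proof.
move: {2}(_ - _)%N (leqnn (#|X| - size s)) => n.
elim: n s => [|n IHn] s.
  rewrite leqn0 subn_eq0 => leXs fs; exists s; split=> //.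
  apply/eqP; rewrite eqn_leq leXs andbT.
  by case/andP: fs => /card_uniqP; rewrite size_map => <- _; exact: max_card.
move=> le_n fs; have [leXs|ltsX] := leqP #|X| (size s).
  by apply: (IHn s) => //; move: leXs; rewrite -subn_eq0 => /eqP->.
have [g fgs] := lr_free_extend1 fs ltsX.
have [|t [ft sub szt]] := IHn _ _ fgs.
  by rewrite /= subnS -ltnS prednK ?subn_gt0.
by exists t; split=> // x xs; apply: sub; rewrite inE xs orbT.
Qed.

Lemma left_cosetE g x : left_coset H g x <-> idx x = idx g.
Proof.
split=> [[h Hh <-]|/esym/idxP Hx].
  by apply/esym/idxP; rewrite mulKg.
by exists (g^-1 * x); rewrite ?mulVKg.
Qed.

Lemma right_cosetE g x : right_coset H g x <-> ridx x = ridx g.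
Proof.
split=> [[h Hh <-]|/ridxP Hx]; first by apply/ridxP; rewrite mulgK.
by exists (x * g^-1); rewrite ?mulgVK.
Qed.

(** Pigeonhole: [#|X|] distinct values exhaust [X]. *)
Lemma uniq_map_hits (f : G -> X) t :
  uniq (map f t) -> size t = #|X| ->
  forall g, exists! x, x \in t /\ f x = f g.
Proof.
move=> Uft szt g.
have: f g \in map f t.
  apply/negPn/negP => gNt; have: uniq (f g :: map f t) by rewrite /= gNt.
  by move/card_uniqP; have := max_card (mem (f g :: map f t)) => /[swap] ->;
    rewrite /= size_map szt ltnn.
case/mapP=> x xt Ex; exists x; split=> // y [yt Ey].
by apply: (uniq_map_inj Uft); rewrite // Ey.
Qed.

Lemma lr_free_transversal s :
  lr_free s -> generates [set` s] ->
  exists T : set G, left_right_transversal H T /\ generates T.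
Proof.
move=> fs gens; have [t [/andP[Ut Vt] st szt]] := lr_free_extend fs.
exists [set` t]; split; last first.
  by apply: generates_sub gens _ => x /= xs; apply: mem_generated; exact: st.
split=> _ [g _ <-].
  have [x [[xt Ex] ux]] := uniq_map_hits Ut szt g.
  exists x; split=> [|y [yt /left_cosetE Ey]]; last exact: ux (conj yt Ey).
  by split=> //; apply/left_cosetE.
have [x [[xt Ex] ux]] := uniq_map_hits Vt szt g.
exists x; split=> [|y [yt /right_cosetE Ey]]; last exact: ux (conj yt Ey).
by split=> //; apply/right_cosetE.
Qed.

(** * Small index, and lists of two or three generators *)

Lemma card_index_le1 : (forall x, H x) -> (#|X| <= 1)%N.
Proof.
move=> HT; apply/card_le1_eqP => i j _ _.
by rewrite -(repK i) -(repK j); apply/idxP.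
Qed.

Lemma card_index_le2 c :
  (forall x, H x \/ H (c^-1 * x)) -> (#|X| <= 2)%N.
Proof.
move=> Hc; apply: leq_trans (card_size [:: idx 1; idx c]).
apply/subset_leq_card/fintype.subsetP => i _; rewrite !inE.
case: (Hc (rep i)) => Hi; apply/orP; [left|right]; apply/eqP.
  by rewrite -[LHS]repK; apply/esym/idxP; rewrite invg1 mul1g.
by rewrite -[LHS]repK; apply/esym/idxP.
Qed.

Definition lr_distinct a b := ~ H (a^-1 * b) /\ ~ H (a * b^-1).

Lemma lr_free_cons a s :
  lr_free (a :: s) <-> {in s, forall b, lr_distinct a b} /\ lr_free s.
Proof.
rewrite /lr_free /= -!andbA; split.
  case/and4P=> /mapP aNs Us /mapP aNs' Vs; split; last by rewrite Us.
  move=> b bs; split=> [/idxP|/ridxP] E; [apply: aNs|apply: aNs'];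
    by exists b.
case=> dist /andP[-> ->]; rewrite andbT /=.
by apply/andP; split; apply/mapP => -[b /dist[ab ab']];
  [move/idxP | move/ridxP].
Qed.

Definition generating_lr_free := exists2 s, lr_free s & generates [set` s].

Lemma lr_distinct_mem a b : H a -> ~ H b -> lr_distinct a b.
Proof.
move=> Ha Hb; split.
  by rewrite subgroupMl // subgroupVE.
by rewrite subgroupMl // subgroupVE.
Qed.

Lemma lr_free2 a b : lr_distinct a b -> lr_free [:: a; b].
Proof.
by move=> dab; apply/lr_free_cons; split=> // x; rewrite inE => /eqP->.
Qed.

Lemma lr_free3 a b c :
  lr_distinct a b -> lr_distinct a c -> lr_distinct b c -> lr_free [:: a; b; c].
Proof.
move=> dab dac /lr_free2 dbc; apply/lr_free_cons; split=> // x.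
by rewrite !inE => /orP[]/eqP->.
Qed.

Lemma generates_all s :
  generates [set` s] -> {in s, forall x, H x} -> forall x, H x.
Proof. by move=> gens sH; apply: generates_subgroup gens sgH _ => x /sH. Qed.

Section GeneratingPairs.
Hypothesis X2 : (2 <= #|X|)%N.

Lemma lr_free_pair_mem (a b : G) :
  generates [set` [:: a; b]] -> H a -> generating_lr_free.
Proof.
move=> genab Ha; exists [:: a; b] => //; apply/lr_free2/lr_distinct_mem => // Hb.
have/card_index_le1 : forall x, H x.
  by apply: generates_all genab _ => x; rewrite !inE => /orP[]/eqP->.
by rewrite leqNgt X2.
Qed.

Lemma lr_free_pair (a b : G) : generates [set` [:: a; b]] -> generating_lr_free.
Proof.
move=> genab.
have [Hl|Hl] := pselect (H (a^-1 * b)).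
  exact: lr_free_pair_mem (generates_divl genab) Hl.
have [Hr|Hr] := pselect (H (a * b^-1)).
  exact: lr_free_pair_mem (generates_divr genab) Hr.
by exists [:: a; b] => //; apply: lr_free2.
Qed.

End GeneratingPairs.

(** The two quotients are [a * c] and the inverse of [c * a], both outside [H]. So a triple [b],
    [c], [c * a * c] with [b] in [H] can fail only when [c * a * c] is in [H]. *)
Lemma lr_distinct_sandwich a c :
  ~ H c -> H a -> lr_distinct c (c * a * c).
Proof.
move=> Hc Ha; split; first by rewrite -mulgA mulKg subgroupMl.
by rewrite !invgM mulVKg subgroupMl // subgroupVE.
Qed.

Section GeneratingTriples.
Hypothesis X3 : (3 <= #|X|)%N.

Lemma lr_free_triple_mem2 (a b c : G) :
  generates [set` [:: a; b; c]] -> H a -> H b -> generating_lr_free.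
Proof.
move=> gens Ha Hb.
have Hc : ~ H c.
  move=> Hc; have/card_index_le1 : forall x, H x.
    by apply: generates_all gens _ => x; rewrite !inE => /or3P[]/eqP->.
  by rewrite leqNgt ltnW.
(* One argument for all three candidate triples, with [x] being [a], [b] or [a * b]. *)
have free_cxc (x y : G) : generates [set` [:: x; y; c]] -> H x -> H y ->
    ~ H (c * x * c) -> generating_lr_free.
  move=> /generates_sandwich genxy Hx Hy Hcxc; exists [:: y; c; c * x * c] => //.
  apply: lr_free3; [exact: lr_distinct_mem.. | exact: lr_distinct_sandwich].
have [Hcac|] := pselect (H (c * a * c)); last exact: free_cxc gens Ha Hb.
have [Hcbc|] := pselect (H (c * b * c)); last first.
  apply: (free_cxc _ a) => //; apply: generates_eq_mem gens => x.
  by rewrite !inE orbCA.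
have [Hcabc|] := pselect (H (c * (a * b) * c)); last first.
  by apply: (free_cxc _ b); [exact: generates_mul | exact: subgroupM |].
(* All three sandwiches are now in [H]. Quotients of them give first [c * a * c^-1], then [c * c],
   and so conjugation by [c] keeps [a] and [b] in [H]. *)
have HcaC : H (c * a * c^-1).
  have := subgroupM sgH Hcabc (subgroupV sgH Hcbc).
  by rewrite !invgM !mulgA !mulgK.
have Hcc : H (c * c).
  have := subgroupM sgH (subgroupV sgH HcaC) Hcac.
  by rewrite !invgM invgK !mulgA !mulgVK.
have conj x : H (c * x * c) -> H (c^-1 * x * c).
  move/(subgroupM sgH (subgroupV sgH Hcc)).
  by rewrite invgM !mulgA mulgVK.
(* [P] is the union of H and cH, and [K] its stabilizer under left translation. *)
pose P x := H x \/ H (c^-1 * x).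
pose K := [set g | forall x, P (g * x) <-> P x].
have sgK : subgroup K.
  apply: subgroup_intro => [x|x y Kx Ky z]; first by rewrite mul1g.
  by rewrite -mulgA Kx -(Ky (y^-1 * z)) mulVKg.
(* Such an [x] fixes each of H and cH, because [x * c = c * (c^-1 * x * c)]. *)
have KH x : H x -> H (c^-1 * x * c) -> K x.
  move=> Hx Hcx y; rewrite /P subgroupMl //.
  suff -> : c^-1 * (x * y) = c^-1 * x * c * (c^-1 * y) by rewrite subgroupMl.
  by rewrite !mulgA mulgK.
(* Since [c * c] is in [H], translation by [c] swaps H and cH. *)
have Kc : K c.
  move=> x; have <- : c * c * (c^-1 * x) = c * x by rewrite !mulgA mulgK.
  rewrite /P subgroupMl // (_ : c^-1 * (c * c * (c^-1 * x)) = x).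
    by split; case; [right|left|right|left].
  by rewrite !mulgA mulVg mul1g mulgV mul1g.
have KT : forall x, K x.
  apply: generates_subgroup gens sgK _ => x.
  by rewrite /= !inE => /or3P[]/eqP-> //; apply: KH => //; exact: conj.
(* As [P] contains 1 and is stable under all of [G], the cosets H and cH cover [G], against [X3]. *)
have/card_index_le2 : forall x, P x.
  by move=> x; rewrite -(mulg1 x); apply/KT; left; exact: subgroup1.
by rewrite leqNgt X3.
Qed.

(** Replacements affect only [b] and [c]; as [a] stays in [H], a shared coset of [b] and [c]
    produces a second generator in [H]. *)
Lemma lr_free_triple_mem1 (a b c : G) :
  generates [set` [:: a; b; c]] -> H a -> generating_lr_free.
Proof.
move=> gens Ha.
have gbca : generates [set` [:: b; c; a]].
  by apply: generates_eq_mem gens => x; rewrite !inE orbC -orbA.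
have [Hb|Hb] := pselect (H b); first exact: lr_free_triple_mem2 gens Ha Hb.
have [Hc|Hc] := pselect (H c).
  apply: (@lr_free_triple_mem2 a c b) => //.
  by apply: generates_eq_mem gens => x; rewrite !inE (orbC (x == b)).
have rot (x y z : G) : generates [set` [:: x; y; z]] -> generates [set` [:: z; x; y]].
  by apply: generates_eq_mem => t; rewrite !inE [RHS]orbC -orbA.
have [Hl|Hl] := pselect (H (b^-1 * c)).
  exact: lr_free_triple_mem2 (rot _ _ _ (generates_divl gbca)) Ha Hl.
have [Hr|Hr] := pselect (H (b * c^-1)).
  exact: lr_free_triple_mem2 (rot _ _ _ (generates_divr gbca)) Ha Hr.
by exists [:: a; b; c] => //; apply: lr_free3 => //; exact: lr_distinct_mem.
Qed.

Lemma lr_free_triple (a b c : G) :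
  generates [set` [:: a; b; c]] -> generating_lr_free.
Proof.
(* A coset shared by the first two generators already settles the claim; reordering the list covers
   all three pairs. *)
have pair (x y z : G) : generates [set` [:: x; y; z]] ->
    generating_lr_free \/ lr_distinct x y.
  move=> gens.
  have [Hl|Hl] := pselect (H (x^-1 * y)).
    by left; exact: lr_free_triple_mem1 (generates_divl gens) Hl.
  have [Hr|Hr] := pselect (H (x * y^-1)); last by right.
  by left; exact: lr_free_triple_mem1 (generates_divr gens) Hr.
move=> gens; have [//|dab] := pair _ _ _ gens.
have gacb : generates [set` [:: a; c; b]].
  by apply: generates_eq_mem gens => x; rewrite !inE (orbC (x == b)).
have gbca : generates [set` [:: b; c; a]].
  by apply: generates_eq_mem gens => x; rewrite !inE orbC -orbA.
have [//|dac] := pair _ _ _ gacb; have [//|dbc] := pair _ _ _ gbca.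
by exists [:: a; b; c] => //; exact: lr_free3.
Qed.

End GeneratingTriples.

End LeftRightTransversal.

(** * Finite index, minimal generating sets and the equivalence *)

Lemma left_coset_eq (G : groupType) (H : set G) (x y : G) : subgroup H ->
  left_coset H x = left_coset H y <-> H (x^-1 * y).
Proof.
move=> sgH; split=> [E|Hxy].
  have : left_coset H y y by exists 1; [exact: subgroup1 | rewrite mulg1].
  by rewrite -E => -[h Hh <-]; rewrite mulKg.
apply/seteqP; split=> _ [h Hh <-]; [exists (y^-1 * x * h)|exists (x^-1 * y * h)].
- by apply: subgroupM => //; rewrite -[y^-1 * x]invgK invgM invgK; exact: subgroupV.
- by rewrite -mulgA mulVKg.
- exact: subgroupM.
- by rewrite -mulgA mulVKg.
Qed.

(** The left cosets themselves form the index type, with representatives supplied by choice; this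
    reduces the counting to finite types. *)
Lemma coset_index_system (G : groupType) (H : set G) :
  subgroup H -> finite_index H ->
  exists (X : finType) (idx : G -> X) (rep : X -> G),
    [/\ forall x y, idx x = idx y <-> H (x^-1 * y), cancel rep idx
      & #|X| = subgroup_index H].
Proof.
move=> sgH fiH; pose F := fset_set (left_cosets H).
have memF g : left_coset H g \in F by rewrite in_fset_set //; apply/mem_set; exists g.
have repF (C : F) : exists g, left_coset H g = val C.
  by have := valP C; rewrite in_fset_set // => /set_mem[g _ E]; exists g.
exists F, (fun g => [` memF g]%fset), (fun C => projT1 (cid (repF C))).
split=> [x y|C|]; last exact/esym/cardfE.
  by rewrite -left_coset_eq //; split=> [/(congr1 val)|E] //; exact: val_inj.
by apply: val_inj; case: cid.
Qed.

Lemma d_leq (G : groupType) n : generating_sizes G n -> (d G <= n)%N.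
Proof.
move=> Gn; rewrite /d; case: xgetP => [m _ [_ min]|]; first exact: min.
by move=> _; exact: leq0n.
Qed.

Lemma d_generating_seq (G : groupType) : finitely_generated G ->
  exists2 s : seq G, size s = d G & generates [set` s].
Proof.
case=> A [/finite_setP[n An] genA].
have : generating_sizes G (d G).
  (* Well-ordering provides a least size, so [d G] is not the default value of [xget]. *)
  pose P m := `[< generating_sizes G m >].
  have exP : exists m, P m by exists n; apply/asboolP; exists A.
  have [m /asboolP Gm minm] := ex_minnP exP.
  rewrite /d; case: xgetP => [k _ [Gk _] //|/(_ m)[]].
  by split=> // k Gk; apply/minm/asboolP.
case=> B [cB genB]; exists (fset_set B : seq G).
  by rewrite (card_fset_set cB).
have finB : finite_set B by apply/finite_setP; exists (d G).
by have /= -> : [set` (fset_set B : seq G)] = B by exact: fset_setK.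
Qed.

Theorem theorem3p12 (G : groupType) (H : set G) (fgG : finitely_generated G)
    (dG : (d G <= 3)%N) (sgH : subgroup H) (fiH : finite_index H) :
  (exists T : set G, left_right_transversal H T /\ generates T) <->
  (subgroup_index H >= d G)%N.
Proof.
have [X [idx [rep [idxP repK <-]]]] := coset_index_system sgH fiH.
split=> [[T [[lT _] genT]]|le_dX].
  (* A left transversal meets each left coset once, so it embeds in [X] and has at most index many
     elements. *)
  have injT : {in T &, injective idx}.
    move=> x y /set_mem Tx /set_mem Ty Exy.
    have [|z [_ uz]] := lT (left_coset H x); first by exists x.
    rewrite -(uz x) ?(uz y) //; split=> //; exact/(left_cosetE idxP).
  have /finite_fsetP[F TF] : finite_set T.
    by rewrite -(eq_finite_set (inj_card_eq injT)); exact: finite_finset.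
  apply: (@leq_trans #|` F|%fset).
    by apply: d_leq; exists T; split=> //; rewrite TF; apply/card_eq_fsetP.
  rewrite cardfE.
  have inj : injective (fun x : F => idx (val x)).
    move=> x y E; apply/val_inj/injT => //; rewrite TF; apply/mem_set/valP.
  exact: leq_card inj.
suff [s fs gens] : generating_lr_free idx.
  exact: (lr_free_transversal sgH idxP repK fs gens).
have [s szs gens] := d_generating_seq fgG.
move: dG le_dX; rewrite -szs; move: gens.
(* Lists of length 0 or 1 have no two entries to compare; longer than 3 is excluded by the bound on
   [d G]. *)
case: s {szs} => [|a [|b [|c [|//]]]] gens _ leX.
- by exists [::].
- by exists [:: a].
- exact: (lr_free_pair sgH idxP repK leX gens).
- exact: (lr_free_triple sgH idxP repK leX gens).
Qed.
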